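(* Let $n\ge 1$ and let $(\mathbf a_1,\ldots,\mathbf a_k)$ be a tuple of non-trivial compositions of $n$. If $(\mathbf a_1,\ldots,\mathbf a_k)$ is of finite type, then $k\le 3$.
   Context: All vector spaces are over a fixed algebraically closed field. A composition of $n$ is a list $\mathbf a=(a_1,\ldots,a_p)$ of nonnegative integers (the parts; zero parts are allowed) with sum $n$. It is trivial if it has only one non-zero part (equal to $n$), and non-trivial otherwise. For a vector space $V$ of dimension $n$, $\mathrm{Fl}_{\mathbf a}(V)$ is the variety of flags $A=(0=A_0\subset A_1\subset\cdots\subset A_p=V)$ of subspaces of $V$ with $\dim(A_i/A_{i-1})=a_i$ for $i=1,\ldots,p$. A tuple $(\mathbf a_1,\ldots,\mathbf a_k)$ of compositions of the same number $n$ is of finite type if $GL(V)$, acting diagonally, has finitely many orbits in $\mathrm{Fl}_{\mathbf a_1}(V)\times\cdots\times\mathrm{Fl}_{\mathbf a_k}(V)$, where $\dim V=n$. *)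

(* Defs.v *)
From mathcomp Require Import all_boot all_algebra.
From mathcomp Require Import boolp classical_sets functions cardinality.

Set Implicit Arguments.
Unset Strict Implicit.
Unset Printing Implicit Defensive.

Import GRing.Theory.

Local Open Scope classical_set_scope.

Definition is_composition (n : nat) (a : seq nat) : Prop := sumn a = n.

Definition trivial_composition (a : seq nat) : Prop :=
  count (fun part => part != 0%N) a = 1%N.

Section Flags.
Variables (K : closedFieldType) (V : vectType K).

(* A flag is indexed by 0, ..., p with p := size a, and its i-th part
   (1 <= i <= p) is nth 0 a (i - 1).  Given the inclusion, the equation on dimensions
   says that the quotient A_(i+1) / A_i has dimension nth 0 a i.  The
   inclusions are not strict since parts may be zero. *)
Definition Fl (a : seq nat) : set ('I_(size a).+1 -> {vspace V}) :=
  [set A | [/\ A ord0 = 0%VS,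
               A ord_max = fullv
             & forall i : 'I_(size a),
                 (A (inord i) <= A (inord i.+1))%VS /\
                 \dim (A (inord i.+1)) = (\dim (A (inord i)) + nth 0 a i)%N]].

Arguments Fl : clear implicits.

Definition flag_family (k : nat) (a : 'I_k -> seq nat) : Type :=
  forall i : 'I_k, 'I_(size (a i)).+1 -> {vspace V}.

Definition Fl_prod (k : nat) (a : 'I_k -> seq nat) : set (flag_family a) :=
  [set A | forall i, Fl (a i) (A i)].

Arguments Fl_prod {k} a.

(* V is finite-dimensional, so injective endomorphisms are invertible. *)
Definition GL : set 'End(V) := [set g | lker g = 0%VS].

Definition GL_orbit (k : nat) (a : 'I_k -> seq nat) (A : flag_family a) :
    set (flag_family a) :=
  [set B | exists2 g : 'End(V), GL g & forall i j, B i j = (g @: A i j)%VS].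

Definition finite_type (k : nat) (a : 'I_k -> seq nat) : Prop :=
  finite_set [set GL_orbit A | A in Fl_prod a].

End Flags.

Arguments Fl {K} V a.
Arguments Fl_prod {K} V {k} a.
Arguments finite_type {K} V {k} a.

(* Main.v *)
(* Four lines in a plane have a continuous invariant, their cross-ratio.  For
   k >= 4, each of the first four flags has a proper nonzero member; for t in K
   take it to be L_i(t) + U_i, where L_0, ..., L_3 are the lines spanned by e1,
   e2, e1 + e2 and e1 + t e2, and where U_i is a coordinate subspace of a fixed
   complement of <e1, e2>, independent of t.  Instead of invoking Krull-Schmidt,
   distinct parameters are separated by counting morphisms: the quadruple of
   lines with parameter s has strictly more morphisms to the configuration with
   parameter s than to any configuration with parameter t <> s.  As K is
   infinite, so is the set of orbits. *)
From HB Require Import structures.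
Require Import Defs.
From mathcomp Require Import all_boot all_algebra.
From mathcomp Require Import boolp classical_sets functions cardinality.

Set Implicit Arguments.
Unset Strict Implicit.
Unset Printing Implicit Defensive.

Import GRing.Theory.

(** If a list exhausted [K], the product of the ['X - x%:P] over it would be a nonzero polynomial
    without a nonroot. *)
Lemma closedField_infinite (K : closedFieldType) : infinite_set [set: K]%classic.
Proof.
move=> /finite_seqP[s sE].
have p_neq0 : (\prod_(x <- s) ('X - x%:P))%R != 0%R :> {poly K}.
  exact: monic_neq0 (monic_prod_XsubC _ _ _).
have /closed_nonrootP[x] := p_neq0.
rewrite root_prod_XsubC => /negP; apply.
by have: [set: K]%classic x by []; rewrite sE.
Qed.

(** Cut just after the first nonzero part: by nontriviality another nonzero part follows. *)
Lemma nontrivial_composition_partial_sum (n : nat) (a : seq nat) :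
  (1 <= n)%N -> is_composition n a -> ~ trivial_composition a ->
  exists j : 'I_(size a).+1, (0 < sumn (take j a) < n)%N.
Proof.
rewrite /is_composition /trivial_composition => n_gt0 aE a_nt.
suff [j j_lt jP] : exists2 j, (j < (size a).+1)%N & (0 < sumn (take j a) < n)%N.
  by exists (Ordinal j_lt).
elim: a aE a_nt => [|x s IHs] /=; first by move=> n0; rewrite -n0 in n_gt0.
have [-> /=|x_neq0] := eqVneq x 0%N.
  rewrite !add0n => sE s_nt; have [j j_lt jP] := IHs sE s_nt.
  by exists j.+1.
move=> xsE s_nt; exists 1%N => //=.
rewrite take0 /= addn0 lt0n x_neq0 /= -xsE -[X in (X < _)%N]addn0 ltn_add2l lt0n.
apply/eqP => s0; apply: s_nt.
rewrite (_ : count _ s = 0%N) //; apply/eqP; rewrite -leqn0 leqNgt -has_count.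
apply/hasPn => y y_s; rewrite negbK -leqn0 -s0.
by elim: {IHs xsE s0} s y_s => //= z s IHs; rewrite inE => /predU1P[->|/IHs];
  rewrite ?leq_addr // => /leq_trans; apply; rewrite leq_addl.
Qed.

Section CrossRatio.
Variables (K : fieldType) (V : vectType K).
Local Open Scope ring_scope.
Local Notation VV := (V * V)%type.

Definition pr1 : 'Hom(VV, V) := linfun fst.
Definition pr2 : 'Hom(VV, V) := linfun snd.

(* The morphisms to the quadruple A from the quadruple of lines <e1>, <e2>,
   <e1 + e2>, <e1 + t e2> in K^2, encoded by the images of e1 and e2. *)
Definition cross_hom (t : K) (A : nat -> {vspace V}) : {vspace VV} :=
  (pr1 @^-1: A 0%N :&: pr2 @^-1: A 1%N :&: (pr1 + pr2) @^-1: A 2%N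
   :&: (pr1 + t *: pr2) @^-1: A 3%N)%VS.

Lemma mem_cross_hom t A x y :
  ((x, y) \in cross_hom t A) =
  [&& x \in A 0%N, y \in A 1%N, x + y \in A 2%N & x + t *: y \in A 3%N].
Proof.
by rewrite !memv_cap -!memv_preim !add_lfunE scale_lfunE !lfunE /= -!andbA.
Qed.

(** Composing with [g], that is, applying it to both components, is injective on morphisms. *)
Lemma cross_hom_dim_le t A B (g : 'End(V)) :
  lker g == 0%VS -> (forall i, (i < 4)%N -> (g @: A i <= B i)%VS) ->
  (\dim (cross_hom t A) <= \dim (cross_hom t B))%N.
Proof.
move=> g_inj gAB.
pose gg (p : VV) : VV := (g p.1, g p.2).
have gg_lin : linear gg by move=> c p q; rewrite /gg !linearP.
pose ggL : {linear VV -> VV} :=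
  HB.pack gg (GRing.isLinear.Build K VV VV _ gg gg_lin).
have ggE p : linfun ggL p = (g p.1, g p.2) by rewrite lfunE.
have/eqP ker0 : lker (linfun ggL) == 0%VS.
  apply/lker0P => -[x y] [x' y']; rewrite !ggE /= => -[].
  by move=> /(lker0P g_inj) -> /(lker0P g_inj) ->.
rewrite -(limg_dim_eq (f := linfun ggL)); last by rewrite ker0 capv0.
apply/dimvS/subvP => _ /memv_imgP[[x y] xyA ->].
move: xyA; rewrite ggE !mem_cross_hom /= => /and4P[x0 y1 xy2 xy3].
have gA i v : (i < 4)%N -> v \in A i -> g v \in B i.
  by move=> i_lt4 /(memv_img g); apply/subvP/gAB.
by rewrite -linearZ -!linearD !gA.
Qed.

Variables (e1 e2 : V) (f1 f2 : {scalar V}).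
Hypotheses (f1e1 : f1 e1 = 1) (f1e2 : f1 e2 = 0).
Hypotheses (f2e1 : f2 e1 = 0) (f2e2 : f2 e2 = 1).

Definition cross_line (t : K) (i : nat) : V :=
  match i with
  | 0%N => e1
  | 1%N => e2
  | 2%N => e1 + e2
  | _ => e1 + t *: e2
  end.

Variable U : nat -> {vspace V}.
Hypothesis fU : forall i u, u \in U i -> f1 u = 0 /\ f2 u = 0.

Definition cross_config (t : K) (i : nat) : {vspace V} :=
  (<[cross_line t i]> + U i)%VS.

Lemma cross_configP t i x : x \in cross_config t i ->
  exists c u, [/\ u \in U i, x = c *: cross_line t i + u,
    f1 x = c * f1 (cross_line t i) & f2 x = c * f2 (cross_line t i)].
Proof.
move=> /memv_addP[_ /vlineP[c ->] [u uU ->]]; exists c, u.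
by have [f1u f2u] := fU uU; rewrite !linearD !linearZ /= f1u f2u !addr0.
Qed.

(** The left space is contained in the right one, and the inclusion [(e1, e2)] of the plane lies
    only in the latter. *)
Lemma cross_hom_config_lt s t : s != t ->
  (\dim (cross_hom s (cross_config t)) < \dim (cross_hom s (cross_config s)))%N.
Proof.
move=> s_neq_t.
(* Modulo the kernels of [f1] and [f2], the first three conditions force [x = c e1] and [y = c e2]
   with the same [c]; the fourth gives [c s = c t], so [c = 0]. *)
have in_t x y : (x, y) \in cross_hom s (cross_config t) ->
    f1 x = 0 /\ x + s *: y \in U 3%N.
  rewrite mem_cross_hom => /and4P[].
  move=> /cross_configP[a [_ [_ _ /= f1x f2x]]].
  move=> /cross_configP[b [_ [_ _ /= f1y f2y]]].
  move=> /cross_configP[c [_ [_ _ /= f1xy f2xy]]].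
  move=> /cross_configP[d [u [uU xyE /= f1z f2z]]].
  move: f1x f2x f1y f2y f1xy f2xy f1z f2z.
  rewrite !linearD !linearZ /= f1e1 f1e2 f2e1 f2e2.
  rewrite !(mulr0, mulr1, addr0, add0r) => _ -> -> _.
  rewrite !(mulr0, addr0, add0r) => -> -> cd; rewrite -cd => /eqP.
  rewrite mulrC -subr_eq0 -mulrBr mulf_eq0 [s - t == 0]subr_eq0.
  rewrite (negPf s_neq_t) orbF => /eqP c0.
  by split=> //; rewrite xyE -cd c0 scale0r add0r.
have sub : (cross_hom s (cross_config t) <= cross_hom s (cross_config s))%VS.
  (* Only the fourth space depends on the parameter, and its summand [U 3] does not. *)
  apply/subvP => -[x y] xy_in; have [_ xyU] := in_t _ _ xy_in.
  move: xy_in; rewrite !mem_cross_hom => /and4P[-> -> -> _] /=.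
  by rewrite -[x + _]add0r memv_add ?mem0v.
rewrite (ltn_leqif (dimv_leqif_sup sub)); apply/negP => /subvP sup.
have: (e1, e2) \in cross_hom s (cross_config s).
  rewrite mem_cross_hom; apply/and4P.
  by split; apply: (subvP (addvSl _ _)); apply: memv_line.
by move=> /sup/in_t[]; rewrite f1e1 => /eqP; rewrite oner_eq0.
Qed.

End CrossRatio.

Lemma scalar_span_eq0 (K : fieldType) (V : vectType K) (f : {scalar V})
    (s : seq V) v :
  (forall x, x \in s -> f x = 0%R) -> v \in <<s>>%VS -> f v = 0%R.
Proof.
move=> f0 /(coord_span (X := in_tuple s)) ->; rewrite linear_sum big1 // => i _.
by rewrite linearZ /= f0 ?mulr0 // mem_nth.
Qed.

Section FlagOfBasis.
Variables (K : closedFieldType) (V : vectType K).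

Definition flag_of_basis (b : seq V) (a : seq nat) (j : 'I_(size a).+1) :
    {vspace V} := <<take (sumn (take j a)) b>>%VS.

Lemma flag_of_basis_Fl b a :
  basis_of fullv b -> is_composition (\dim (fullv : {vspace V})) a ->
  Fl V a (flag_of_basis b (a := a)).
Proof.
move=> b_basis aE; have sz_b : size b = \dim (fullv : {vspace V}).
  exact/esym/(size_basis (X := in_tuple b)).
have b_free := basis_free b_basis.
have sum_le j : (sumn (take j a) <= size b)%N.
  by rewrite sz_b -aE -[X in (_ <= sumn X)%N](cat_take_drop j) sumn_cat
    leq_addr.
have dim_take m : (m <= size b)%N -> \dim <<take m b>> = m.
  move=> m_le; have: free (take m b).
    by move: b_free; rewrite -{1}(cat_take_drop m b) => /catl_free.
  by rewrite /free => /eqP ->; rewrite size_takel.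
split; rewrite /flag_of_basis /=.
- by rewrite !take0 span_nil.
- by rewrite take_size aE -sz_b take_size (span_basis b_basis).
move=> i; have i_lt := ltn_ord i.
rewrite !inordK ?ltnS //; last exact: ltnW.
rewrite !dim_take // (take_nth 0%N i_lt) -cats1 sumn_cat /= addn0; split=> //.
by rewrite takeD span_cat addvSl.
Qed.

End FlagOfBasis.

Section CrossBasis.
Variables (K : fieldType) (V : vectType K) (e1 e2 : V) (u : seq V).

(** The line's vector is put in position [d], so that the member of dimension [d] of the flag of
    this basis is the wanted one. The vector after it completes it to a basis of the plane of [e1]
    and [e2]. *)
Definition cross_basis (t : K) (i d : nat) : seq V :=
  take d.-1 u ++ [:: cross_line e1 e2 t i; if i == 1%N then e1 else e2]
    ++ drop d.-1 u.

Lemma cross_basis_basis t i d :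
  basis_of fullv (e1 :: e2 :: u) -> basis_of fullv (cross_basis t i d).
Proof.
move=> X_basis; rewrite (perm_basis (Y := [:: cross_line e1 e2 t i;
    if i == 1%N then e1 else e2] ++ u)); last first.
  by rewrite /cross_basis perm_catCA cat_take_drop.
move: X_basis; rewrite !basisEdim => /andP[sub sz].
apply/andP; split=> //; apply: subv_trans sub _.
rewrite -[e1 :: _]/([:: e1; e2] ++ u) !span_cat addvS //.
set s := [:: cross_line _ _ _ _; _].
have [m0 m1] : (s`_0 \in <<s>>%VS /\ s`_1 \in <<s>>%VS)%R.
  by rewrite !memv_span ?mem_nth.
apply/span_subvP => x; rewrite !inE => /orP[]/eqP ->; move: m0 m1;
  rewrite /s; case: i s => [|[|[|i]]] _ //= m0 m1.
- by have := memvB m0 m1; rewrite addrK.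
- by have := memvB m0 (memvZ t m1); rewrite addrK.
Qed.

Lemma span_take_cross_basis t i d : (0 < d)%N -> (d.-1 <= size u)%N ->
  <<take d (cross_basis t i d)>>%VS =
  cross_config e1 e2 (fun=> <<take d.-1 u>>%VS) t i.
Proof.
move=> d_gt0 d_le; rewrite /cross_basis catA takel_cat; last first.
  by rewrite size_cat size_takel //= addn2; case: (d) d_gt0.
rewrite take_cat size_takel // ltnNge leq_pred /=.
have -> : (d - d.-1 = 1)%N by case: (d) d_gt0 => // d' _; rewrite subSnn.
by rewrite span_cat span_seq1 addvC.
Qed.

End CrossBasis.

Theorem theorem2p1 (K : closedFieldType) (n : nat) (hn : (1 <= n)%N)
    (V : vectType K) (dimV : \dim (fullv : {vspace V}) = n)
    (k : nat) (a : 'I_k -> seq nat)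
    (a_comp : forall i, is_composition n (a i))
    (a_nontrivial : forall i, ~ trivial_composition (a i)) :
  finite_type V a -> (k <= 3)%N.
Proof.
move=> fin; rewrite leqNgt; apply/negP => k_gt3.
case: k k_gt3 a a_comp a_nontrivial fin => // k k_gt3 a a_comp a_nt fin.
have jP i := nontrivial_composition_partial_sum hn (a_comp i) (@a_nt i).
pose j i := xchoose (jP i); pose d i := sumn (take (j i) (a i)).
have dP i : (0 < d i < n)%N := xchooseP (jP i).
have /andP[d0_gt0 d0_lt] := dP ord0.
(* A dimension strictly between 0 and [n] leaves room for a plane. *)
have [m nE] : exists m, n = m.+2.
  by exists n.-2; case: (n) (leq_ltn_trans d0_gt0 d0_lt) => [|[|]].
have [X X_basis] : exists X : m.+2.-tuple V, basis_of fullv X.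
  rewrite -nE -dimV; exists (vbasis fullv); exact: vbasisP.
have coordX := coord_free _ _ (basis_free X_basis).
case/tupleP: X X_basis coordX => e1 X'; case/tupleP: X' => e2 u X_basis coordX.
pose X : m.+2.-tuple V := [tuple of e1 :: e2 :: u].
pose i1 : 'I_m.+2 := lift ord0 ord0.
pose U i := <<take (d (inord i)).-1 u>>%VS.
have fU i x : x \in U i -> coord X ord0 x = 0%R /\ coord X i1 x = 0%R.
  (* The entry [p] of [u] is the entry [p + 2] of the basis, so its first two coordinates vanish. *)
  move=> xU; split; apply: (scalar_span_eq0 _ xU) => y /mem_take /(nthP 0%R)[p];
    rewrite size_tuple => p_lt <-;
    exact: (coordX (lift ord0 (lift ord0 (Ordinal p_lt)))).
pose M t : flag_family V a := fun i =>
  flag_of_basis (cross_basis e1 e2 u t i (d i)) (a := a i).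
have M_Fl t : Fl_prod V a (M t).
  move=> i; apply: flag_of_basis_Fl; first exact: cross_basis_basis X_basis.
  by rewrite dimV.
have MjE t (i : nat) : (i < k.+1)%N ->
    M t (inord i) (j (inord i)) = cross_config e1 e2 U t i.
  move=> i_lt; have /andP[d_gt0 d_lt] := dP (inord i).
  rewrite /M /flag_of_basis span_take_cross_basis ?inordK //.
  by rewrite size_tuple -ltnS prednK // -ltnS -nE.
apply: (@closedField_infinite K).
have -> : [set: K]%classic =
    ((fun t => GL_orbit (M t)) @^-1` [set GL_orbit A | A in Fl_prod V a])%classic.
  by apply/seteqP; split=> // t _; exists (M t).
(* It remains to see that [t] is determined by the orbit of [M t]. *)
apply: finite_preimage fin => s t _ _ orbE.
have [//|s_neq_t] := eqVneq s t.
have : GL_orbit (M s) (M s).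
  exists \1%VF; first by apply/eqP/lker0P => x y; rewrite !id_lfunE.
  by move=> i l; rewrite lim1g.
(* Here [g] carries [M t] to [M s], so the strict inequality is used with the roles of [s] and [t]
   exchanged. *)
rewrite /= orbE => -[g]; rewrite /GL /= => /eqP g_inj gM.
have : (\dim (cross_hom t (cross_config e1 e2 U t)) <=
        \dim (cross_hom t (cross_config e1 e2 U s)))%N.
  apply: (@cross_hom_dim_le _ _ _ _ _ g) => //.
  move=> i i_lt4; have i_ltk : (i < k.+1)%N := leq_trans i_lt4 k_gt3.
  by rewrite -!MjE // gM.
rewrite leqNgt (@cross_hom_config_lt _ _ e1 e2 (coord X ord0) (coord X i1)) //.
- exact: (coordX ord0).
- exact: (coordX i1 ord0).
- exact: (coordX ord0 i1).
- exact: (coordX i1).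
- by rewrite eq_sym.
Qed.
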